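(* Let $\rho$ and $e^{-\Psi}$ be (densities of) probability measures on $\mathbb{S}^1$ such that $\rho,\Psi\in C^1(\mathbb{S}^1)$ and $|\Psi|\le\lambda$ on $\mathbb{S}^1$ for some constant $\lambda$. For any fixed positive constant $\varepsilon_*\le\frac1{10}$, if $$\|\rho e^{\Psi}-1\|_{L^\infty(\mathbb{S}^1)}\le\varepsilon_*,$$ then $$H(\rho|e^{-\Psi})\le\frac{2\pi^2e^{2\lambda}\left(1+\frac1{15}\varepsilon_*\right)}{1-\frac76\varepsilon_*}\,I(\rho|e^{-\Psi}).$$
   Context: $\mathbb{S}^1$ is the unit circle of $\mathbb{R}^2$ with its standard (ambient) metric, $d\omega$ is its arc-length measure (total mass $2\pi$), and $\nabla$ is the gradient on $\mathbb{S}^1$. Probability measures are identified with their densities with respect to $d\omega$. The relative entropy and relative Fisher information with respect to $e^{-\Psi}d\omega$ are $$H(\rho|e^{-\Psi})=\int_{\mathbb{S}^1}\log\Big(\frac{\rho}{e^{-\Psi}}\Big)\rho\,d\omega,\qquad I(\rho|e^{-\Psi})=\int_{\mathbb{S}^1}\Big|\nabla\log\frac{\rho}{e^{-\Psi}}\Big|^2\rho\,d\omega .$$ *)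

(* Defs.v *)
From HB Require Import structures.
From mathcomp Require Import all_boot all_order all_algebra.
From mathcomp Require Import all_classical all_reals all_analysis.
From mathcomp Require Import measurable_realfun ring.
Import Order.TTheory GRing.Theory Num.Theory.
Import numFieldNormedType.Exports.

Set Implicit Arguments.
Unset Strict Implicit.
Unset Printing Implicit Defensive.

Local Open Scope classical_set_scope.
Local Open Scope ring_scope.

Definition circle (R : realType) : set (R * R) :=
  [set p | p.1 ^+ 2 + p.2 ^+ 2 = 1].

(* S1 carries the topology induced by R^2 (that of the ambient metric) and
   the corresponding Borel sigma-algebra. *)
Definition S1 (R : realType) : Type := set_type (@circle R).

HB.instance Definition _ (R : realType) :=
  Topological.copy (S1 R) (set_type (@circle R)).

Section S1.
Context {R : realType}.
Implicit Types (w : S1 R) (f g : S1 R -> R) (t : R).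

Definition S1_coord w : R * R := set_val w.

Lemma S1P w : (S1_coord w).1 ^+ 2 + (S1_coord w).2 ^+ 2 = 1.
Proof. by have := set_valP w. Qed.

Definition S1_of (p : R * R) (hp : circle p) : S1 R := exist _ p (mem_set hp).

Let base_subproof : circle ((1, 0) : R * R).
Proof. by rewrite /circle /= expr1n expr0n addr0. Qed.

Definition S1_base : S1 R := S1_of base_subproof.

HB.instance Definition _ := isPointed.Build (S1 R) S1_base.

HB.instance Definition _ :=
  Measurable.copy (S1 R) (g_sigma_algebraType (@open (S1 R))).

Let rotate_subproof t w : circle
  (cos t * (S1_coord w).1 - sin t * (S1_coord w).2,
   sin t * (S1_coord w).1 + cos t * (S1_coord w).2).
Proof.
rewrite /circle /=; set x := _.1; set y := _.2.
have -> : (cos t * x - sin t * y) ^+ 2 + (sin t * x + cos t * y) ^+ 2 =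
    (cos t ^+ 2 + sin t ^+ 2) * (x ^+ 2 + y ^+ 2) by ring.
by rewrite S1P cos2Dsin2 mulr1.
Qed.

(* t |-> S1_rotate t w is the unit-speed counterclockwise curve in S1
   that is at w when t = 0. *)
Definition S1_rotate t w : S1 R := S1_of (rotate_subproof t w).

Definition S1_param (t : measurableTypeR R) : S1 R := S1_rotate t S1_base.

Lemma S1_paramE t : S1_coord (S1_param t) = (cos t, sin t).
Proof.
by rewrite /S1_coord /= set_valE /= !mulr1 !mulr0 subr0 addr0.
Qed.

Lemma continuous_S1_param : continuous (S1_param : R -> S1 R).
Proof.
apply: (@continuous_comp_initial _ _ _ set_val) => t.
have -> : set_val \o S1_param = (fun s : R => (cos s, sin s)).
  by apply/funext => s; exact: S1_paramE.
exact: (cvg_pair (@continuous_cos R t) (@continuous_sin R t)).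
Qed.

Lemma measurable_S1_param : measurable_fun [set: measurableTypeR R] S1_param.
Proof.
apply: (@measurability _ _ (measurableTypeR R) (S1 R) _ _ (@open (S1 R))).
  by [].
move=> _ [U oU <-]; rewrite setTI; apply: open_measurable.
have /continuousP := continuous_S1_param; exact.
Qed.

(* d omega: S1_param is injective on [0, 2 pi[, onto, and of unit speed. *)
Definition arc_length : set (S1 R) -> \bar R :=
  pushforward
    (mrestr (@lebesgue_measure R) (measurable_itv `[0, 2 * pi[)) S1_param.

Let arc_length0 : arc_length set0 = 0%E.
Proof. by apply: measure0; exact: measurable_S1_param. Qed.

Let arc_length_ge0 A : (0 <= arc_length A)%E.
Proof. by apply: measure_ge0; exact: measurable_S1_param. Qed.

Let arc_length_sigma_additive : semi_sigma_additive arc_length.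
Proof. by apply: measure_semi_sigma_additive; exact: measurable_S1_param. Qed.

HB.instance Definition _ := isMeasure.Build _ _ _ arc_length
  arc_length0 arc_length_ge0 arc_length_sigma_additive.

Lemma arc_length_setT : arc_length [set: S1 R] = (2 * pi)%:E.
Proof.
rewrite /arc_length /pushforward /mrestr preimage_setT setTI.
by rewrite lebesgue_measure_itv /= lte_fin mulr_gt0 ?pi_gt0// oppr0 adde0.
Qed.

(* Derivative along the unit tangent (- y, x) at (x, y). *)
Definition S1_derive f w : R := 'D_1 (fun t => f (S1_rotate t w)) 0.

Definition S1_grad f w : R * R :=
  (S1_derive f w * - (S1_coord w).2, S1_derive f w * (S1_coord w).1).

Definition S1_C1 f : Prop :=
  [/\ continuous f,
      forall w, derivable (fun t => f (S1_rotate t w)) 0 1 &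
      continuous (S1_derive f)].

(* |v|^2 for the Euclidean norm (`|v| on R * R would be the max norm). *)
Definition sqr_enorm (v : R * R) : R := v.1 ^+ 2 + v.2 ^+ 2.

Local Open Scope ereal_scope.

Definition S1_pdf f : Prop :=
  [/\ measurable_fun [set: S1 R] f, forall w, (0 <= f w)%R &
      \int[arc_length]_w (f w)%:E = 1].

Definition rel_entropy f g : \bar R :=
  \int[arc_length]_w (ln (f w / g w) * f w)%:E.

Definition rel_Fisher f g : \bar R :=
  \int[arc_length]_w (sqr_enorm (S1_grad (fun v => ln (f v / g v)) w) * f w)%:E.

End S1.

(* Main.v *)
(** Put u := rho e^Psi, with minimum m and maximum M on the circle. As u
averages to 1 against e^-Psi, m <= 1 <= M, so u ln u <= (u - 1) + (u - 1)^2
integrates to H <= (M - m)^2. Cauchy-Schwarz along an arc joining the extremal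
points gives (M - m)^2 <= 2 pi \int |u'|^2, and
|u'|^2 = (rho |(ln u)'|^2) u e^Psi <= (1 + eps) e^lambda rho |(ln u)'|^2.
Hence H <= 2 pi (1 + eps) e^lambda I, which suffices since
(1 + eps) (1 - 7/6 eps) <= 1 <= pi e^lambda. *)

Require Import Defs.
From HB Require Import structures.
From mathcomp Require Import all_boot all_order all_algebra.
From mathcomp Require Import all_classical all_reals all_analysis.
From mathcomp Require Import measurable_realfun ring lra.
Import Order.TTheory GRing.Theory Num.Theory.
Import numFieldNormedType.Exports.

Set Implicit Arguments.
Unset Strict Implicit.
Unset Printing Implicit Defensive.

Local Open Scope classical_set_scope.
Local Open Scope ring_scope.

Section S1_theory.
Context {R : realType}.
Implicit Types (w : S1 R) (f : S1 R -> R) (s t : R).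

(** * Rotations and the angular parametrization of the circle *)

Lemma S1_rotateD s t w : S1_rotate s (S1_rotate t w) = S1_rotate (s + t) w.
Proof.
apply: val_inj => /=; rewrite cosD sinD; congr (_, _);
  rewrite /S1_coord /= set_valE /=; ring.
Qed.

Lemma S1_paramD s t : S1_rotate s (S1_param t) = S1_param (s + t).
Proof. exact: S1_rotateD. Qed.

Lemma S1_rotate0 w : S1_rotate 0 w = w.
Proof.
apply: val_inj => /=; rewrite cos0 sin0 !mul1r !mul0r subr0 add0r.
by rewrite -surjective_pairing /S1_coord set_valE.
Qed.

(** The angle is [acos x] on the closed upper half circle and its reflection [2 * pi - acos x] on
    the open lower half. *)
Lemma S1_param_surj w : exists2 t, 0 <= t < 2 * pi & S1_param t = w.
Proof.
have := S1P w; case E : (S1_coord w) => [x y] /= xy1.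
have x1 : -1 <= x <= 1 by have y2 := sqr_ge0 y; apply/andP; split; nra.
have ysqr : y ^+ 2 = 1 - x ^+ 2 by rewrite -xy1; ring.
have cosx : cos (acos x) = x by rewrite acosK // in_itv.
have sinx : sin (acos x) = `|y| by rewrite sin_acos // -ysqr sqrtr_sqr.
have pi0 := pi_gt0 R.
have inj t : cos t = x -> sin t = y -> S1_param t = w.
  by move=> ct st; apply: val_inj; have := S1_paramE t;
    rewrite /S1_coord !set_valE /= ct st -E /S1_coord set_valE => ->.
have [y0|y0] := leP 0 y.
  exists (acos x); last by apply: inj => //; rewrite sinx ger0_norm.
  by rewrite acos_ge0 //= (le_lt_trans (acos_lepi x1)) //; lra.
exists (2 * pi - acos x).
  (* The range of angles excludes [2 * pi], so [acos x] must not vanish; its sine is [|y|], nonzero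
     here. *)
  have a_neq0 : 0 != acos x.
    apply/eqP => a0.
    by move: sinx; rewrite -a0 sin0 => /esym/eqP; rewrite normr_eq0 lt_eqF.
  have a_gt0 : 0 < acos x by rewrite lt_neqAle a_neq0 acos_ge0.
  by have := acos_lepi x1 => a_lepi; apply/andP; split; lra.
have e : 2 * pi - acos x = - acos x + pi *+ 2 by ring.
apply: inj; rewrite e.
  by rewrite cosD2pi cosN.
by rewrite sinD2pi sinN sinx ltr0_norm // opprK.
Qed.

(** [S1_C1] differentiates only at parameter 0 of the curve through each point. Rotating by [t]
    first moves that information to an arbitrary [t]. *)
Lemma is_derive_S1_param f t :
  S1_C1 f -> is_derive t 1 (f \o S1_param : R -> R) (S1_derive f (S1_param t)).
Proof.
case=> _ df _; pose g s := f (S1_rotate s (S1_param t)).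
have -> : f \o S1_param = g \o (fun x => x - t).
  by apply/funext => x; rewrite /g /= S1_paramD subrK.
have dg : is_derive (t - t) 1 g (S1_derive f (S1_param t)).
  by rewrite subrr; apply: DeriveDef => //; exact: df.
have dt : is_derive t 1 (fun x : R => x - t) 1.
  by apply: is_derive_eq; rewrite subr0.
by have := @is_derive1_comp R g (fun x => x - t) t _ _ dg dt; rewrite mulr1.
Qed.

(** * Continuous functions and arc length *)

Lemma continuous_measurable_fun_S1 f :
  continuous f -> measurable_fun [set: S1 R] f.
Proof.
move=> /continuousP cf; apply: (measurability _ (RGenOpens.measurableE R)).
move=> _ [_ [a [b ->] <-]]; rewrite setTI; apply: sub_sigma_algebra.
by apply: cf; exact: interval_open.
Qed.

(** If the bound failed at one point, continuity would make it fail on an arc of positive length,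
    inside the null exceptional set. *)
Lemma Lnormy_continuous_le f (e : R) : continuous f ->
  ('N[arc_length]_+oo[EFin \o f] <= e%:E)%E -> forall w, `|f w| <= e.
Proof.
move=> cf.
(* The norm of exponent infinity is an essential supremum only for a measure of positive total mass;
   otherwise it defaults to 0. *)
have mT : (0 < arc_length [set: S1 R])%E.
  by rewrite arc_length_setT lte_fin mulr_gt0 ?pi_gt0.
rewrite unlock mT.
case/ess_sup_inf.ess_supP => N [mN N0 sN] w; rewrite leNgt; apply/negP => lt_e.
have [t /andP[t0 t2pi] tw] := S1_param_surj w.
have cg : {for t, continuous (fun s : R => `|f (S1_param s)|)}.
  apply: (@continuous_comp _ _ _ (f \o S1_param) Num.norm).
    by apply: continuous_comp; [exact: continuous_S1_param|exact: cf].
  exact: norm_continuous.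
have /(cvgr_gt _ cg)/nbhs_ballP[d d0 dP] : e < `|f (S1_param t)| by rewrite tw.
(* Capping [l] by [2 * pi - t] keeps [[t, t + l[] inside [[0, 2 * pi[], where [arc_length] sees it;
   extending only to the right also covers [t = 0]. *)
pose l := Num.min d (2 * pi - t).
have l0 : 0 < l by rewrite lt_min d0 subr_gt0.
have : (@lebesgue_measure R `[t, (t + l)%R[%classic <= arc_length N)%E.
  apply: le_measure; rewrite ?inE //.
    by apply: measurableI => //; rewrite -[X in measurable X]setTI;
      exact: measurable_S1_param.
  move=> s /=; rewrite !in_itv /= => /andP[ts sl].
  have [sd s2] : s < t + d /\ s < 2 * pi.
    by move: sl; rewrite -ltrBlDl lt_min => /andP[? ?]; lra.
  split; last by rewrite s2 (le_trans t0).
  apply: sN => /=; rewrite lee_fin leNgt => /negP; apply.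
  by apply: dP; rewrite /ball /= distrC ger0_norm ?subr_ge0 //; lra.
rewrite N0 lebesgue_measure_itv /= lte_fin ltrDl l0 -EFinD lee_fin.
by apply/negP; rewrite -ltNge; lra.
Qed.

Lemma arc_length_ge_itv (g : S1 R -> \bar R) (a b : R) :
  measurable_fun [set: S1 R] g -> (forall w, 0 <= g w)%E ->
  0 <= a -> b <= 2 * pi ->
  (\int[lebesgue_measure]_(t in `[a, b]) g (S1_param t) <=
   \int[arc_length]_w g w)%E.
Proof.
move=> mg g0 a0 b2pi.
have mgp : measurable_fun [set: measurableTypeR R] (g \o S1_param).
  exact: (measurableT_comp mg (@measurable_S1_param R)).
(* The endpoint [b] may be [2 * pi], outside the interval that defines [arc_length]; it is dropped
   as a null set. *)
rewrite -integral_itv_bndo_bndc; last exact: measurable_funTS mgp.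
rewrite (@ge0_integral_pushforward _ _ _ _ _ _ (@measurable_S1_param R)) //.
rewrite preimage_setT.
set nu := (X in (_ <= integral X _ _)%E).
apply: le_trans (_ : _ <= \int[nu]_(t in `[a, b[) g (S1_param t))%E _.
  rewrite (eq_measure_integral nu) // => A mA Aab.
  rewrite /nu /= /mrestr setIidl // => t /Aab /=.
  rewrite !in_itv /= => /andP[at_ tb].
  by rewrite (le_trans a0) // (lt_le_trans tb).
by apply: ge0_subset_integral.
Qed.

(** * Energy bound for the oscillation, and extrema *)

Lemma sqr_increment_le (f g : R -> R) (a b : R) : a < b ->
  (forall t, is_derive t 1 f (g t)) -> continuous g ->
  (((f b - f a) ^+ 2 / (b - a))%:E <=
   \int[lebesgue_measure]_(t in `[a, b]) (g t ^+ 2)%:E)%E.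
Proof.
(* Cauchy-Schwarz by integrating [2 c g - c^2 <= g^2], with c the mean of g. *)
move=> ab df cg; pose c := (f b - f a) / (b - a).
pose F t := 2 * c * f t - c ^+ 2 * t.
pose G t := 2 * c * g t - c ^+ 2.
have dF t : is_derive t 1 F (G t).
  have := df t => dft; rewrite /F /G.
  by apply: is_derive_eq; rewrite /GRing.scale /= !mulr1.
have cF : continuous F.
  by move=> t; apply: differentiable_continuous; apply/derivable1_diffP.
have cG : continuous G.
  move=> t; apply: cvgB; last exact: cvg_cst.
  by apply: cvgM; [exact: cvg_cst|exact: cg].
have <- : (\int[lebesgue_measure]_(t in `[a, b]) (G t)%:E =
    ((f b - f a) ^+ 2 / (b - a))%:E)%E.
  rewrite (@continuous_FTC2 _ G F) //.
  - rewrite -EFinB /F /c; congr (_%:E); field.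
    by rewrite subr_eq0 gt_eqF.
  - exact: continuous_subspaceT.
  - split.
    + by move=> t _; exact: ex_derive.
    + by apply: cvg_at_right_filter; exact: cF.
    + by apply: cvg_at_left_filter; exact: cF.
  - by move=> t _; rewrite derive1E; exact: derive_val.
apply: le_integral => //.
- apply: continuous_compact_integrable; first exact: segment_compact.
  exact: continuous_subspaceT.
- apply: (@continuous_compact_integrable _ (fun t => g t ^+ 2)).
    exact: segment_compact.
  apply: continuous_subspaceT => t.
  by apply: (@continuous_comp _ _ _ g (fun x => x ^+ 2));
    [exact: cg|exact: exprn_continuous].
move=> t _; rewrite lee_fin /G -subr_ge0.
by rewrite (_ : _ - _ = (g t - c) ^+ 2) ?sqr_ge0 //; ring.
Qed.

(** The arc is the one between the two angles in [[0, 2 * pi[], not necessarily the shorter one. Its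
    length is at most [2 * pi], and its energy at most that of the whole circle. *)
Lemma S1_oscillation_le f (x y : S1 R) : S1_C1 f ->
  (((f x - f y) ^+ 2)%:E <=
   (2 * pi)%:E * \int[arc_length]_w (S1_derive f w ^+ 2)%:E)%E.
Proof.
move=> f_C1; have [_ _ cdf] := f_C1.
have pi0 := pi_gt0 R.
have [a /andP[a0 a2pi] <-] := S1_param_surj x.
have [b /andP[b0 b2pi] <-] := S1_param_surj y.
wlog ab : a b a0 a2pi b0 b2pi / a <= b.
  move=> h; have [|/ltW] := leP a b; first exact: h.
  by rewrite -(sqrrN (_ - _)) opprB; exact: h.
have int0 : (0 <= \int[arc_length]_w (S1_derive f w ^+ 2)%:E)%E.
  by apply: integral_ge0 => w _; rewrite lee_fin sqr_ge0.
(* Equal angles are treated apart, since the Cauchy-Schwarz bound divides by [b - a]. *)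
move: ab; rewrite le_eqVlt => /predU1P[->|ab].
  by rewrite subrr expr0n mule_ge0 // lee_fin; lra.
have ba0 : 0 < b - a by rewrite subr_gt0.
apply: (@le_trans _ _ ((b - a)%:E * \int[arc_length]_w (S1_derive f w ^+ 2)%:E)%E);
  last by apply: lee_wpmul2r => //; rewrite lee_fin; lra.
rewrite -lee_pdivrMl // -EFinM mulrC -(sqrrN (_ - _)) opprB.
apply: le_trans (@arc_length_ge_itv _ a b _ _ a0 (ltW b2pi)).
- apply: (@sqr_increment_le (f \o S1_param) (S1_derive f \o S1_param)) => //.
    by move=> t; exact: is_derive_S1_param.
  by move=> t; apply: continuous_comp; [exact: continuous_S1_param|exact: cdf].
- apply/measurable_EFinP; apply: measurable_funX.
  exact: continuous_measurable_fun_S1.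
- by move=> w; rewrite lee_fin sqr_ge0.
Qed.

Lemma S1_EVT f : continuous f -> exists x y, forall w, f x <= f w <= f y.
Proof.
move=> cf; have pi0 := pi_gt0 R.
have cfp : {within `[0, 2 * pi], continuous (f \o S1_param : R -> R)}.
  apply: continuous_subspaceT => t.
  by apply: continuous_comp; [exact: continuous_S1_param|exact: cf].
have le0 : 0 <= 2 * pi :> R by lra.
have [a _ amin] := EVT_min le0 cfp.
have [b _ bmax] := EVT_max le0 cfp.
exists (S1_param a), (S1_param b) => w.
have [t /andP[t0 t2pi] <-] := S1_param_surj w.
have tin : t \in `[0, 2 * pi] by rewrite in_itv /= t0 ltW.
by rewrite (amin _ tin) (bmax _ tin).
Qed.

(** * Entropy bounded by the squared oscillation of the density ratio *)

Lemma S1_pdf_integrable f : S1_pdf f ->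
  integrable (@arc_length R) [set: S1 R] (EFin \o f).
Proof.
move=> [mf f0 f1]; apply/integrableP; split; first exact/measurable_EFinP.
rewrite (eq_integral (EFin \o f)); first by rewrite f1 ltry.
by move=> w _ /=; rewrite ger0_norm.
Qed.

Lemma ln_le_subr1 (x : R) : 0 < x -> ln x <= x - 1.
Proof.
by move=> x0; have := expR_ge1Dx (ln x); rewrite lnK ?posrE //; lra.
Qed.

(** With [u = f / g] and [D = (M - m) ^+ 2], the integrand is at most [f + (D - 1) * g], whose
    integral is [D] because both densities have mass 1. *)
Lemma rel_entropy_le f g (m M : R) :
  S1_pdf f -> S1_pdf g -> continuous f -> continuous g ->
  (forall w, 0 < g w) -> 0 < m -> (forall w, m <= f w / g w <= M) ->
  (rel_entropy f g <= ((M - m) ^+ 2)%:E)%E.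
Proof.
move=> f_pdf g_pdf cf cg g0 m0 u_bnd.
have [_ _ f1] := f_pdf; have [_ _ g1] := g_pdf.
have intf := S1_pdf_integrable f_pdf; have intg := S1_pdf_integrable g_pdf.
pose u w := f w / g w.
have fE w : f w = u w * g w by rewrite /u divfK // gt_eqF.
have u0 w : 0 < u w by have /andP[+ _] := u_bnd w; exact: lt_le_trans.
(* Integrate [m * g <= f]; the bound on [M] is symmetric. *)
have m_le1 : m <= 1.
  rewrite -lee_fin -f1 -[m%:E]mule1 -g1 -integralZl //.
  apply: le_integral => //; first exact: integrableZl.
  move=> w _; rewrite -EFinM lee_fin fE ler_pM2r //.
  by have /andP[] := u_bnd w.
have M_ge1 : 1 <= M.
  rewrite -lee_fin -f1 -[M%:E]mule1 -g1 -integralZl //.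
  apply: le_integral => //; first exact: integrableZl.
  move=> w _; rewrite -EFinM lee_fin fE ler_pM2r //.
  by have /andP[] := u_bnd w.
have cu : continuous u.
  move=> w; apply: (continuousM (cf w)); apply: continuousV (cg w).
  by rewrite gt_eqF.
have lnu_le w : ln (u w) <= u w - 1 by exact: ln_le_subr1.
(* This is [ln_le_subr1] at the inverse of [u w], multiplied by [u w]. *)
have lnu_ge w : u w - 1 <= u w * ln (u w).
  have := @ln_le_subr1 (u w)^-1; rewrite invr_gt0 lnV ?posrE // => /(_ (u0 w)).
  have := u0 w => uw0; rewrite -(ler_pM2l uw0) mulrBr mulfV ?gt_eqF //; lra.
pose D := (M - m) ^+ 2.
(* After division by [g w]: [u * ln u <= u * (u - 1) = (u - 1) + (u - 1) ^+ 2], and [m <= 1 <= M]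
   gives [(u - 1) ^+ 2 <= D]. *)
have h_le w : ln (u w) * f w <= f w + (D - 1) * g w.
  rewrite fE mulrA -mulrDl ler_pM2r // /D.
  by have /andP[] := u_bnd w; have := lnu_le w; have := u0 w;
    rewrite -/(u w); nra.
(* Domination for the integrability of the entropy integrand: [-1 <= u - 1 <= u * ln u <= u * (u -
   1) <= M ^+ 2]. *)
have h_abs w : `|ln (u w) * f w| <= (1 + M ^+ 2) * g w.
  rewrite fE mulrA normrM (ger0_norm (ltW (g0 w))) ler_pM2r //.
  rewrite ler_norml; have := lnu_ge w; have := lnu_le w; have := u0 w.
  by have /andP[] := u_bnd w; rewrite -/(u w) => *; apply/andP; split; nra.
have intDg := integrableZl measurableT (D - 1) intg.
have -> : D%:E = (\int[arc_length]_w (f w + (D - 1) * g w)%:E)%E.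
  under eq_integral do rewrite EFinD EFinM.
  rewrite (integralD measurableT intf intDg) integralZl // f1 g1 mule1.
  by rewrite -EFinD; congr (_%:E); ring.
apply: le_integral => //.
- apply: (le_integrable measurableT _ _
    (integrableZl measurableT (1 + M ^+ 2) intg)).
    apply/measurable_EFinP; apply: measurable_funM.
      apply: measurableT_comp; first exact: measurable_ln.
      exact: continuous_measurable_fun_S1.
    exact: continuous_measurable_fun_S1.
  move=> w _ /=; rewrite lee_fin (le_trans (h_abs w)) //.
  exact: ler_norm.
- apply: (eq_integrable measurableT
    (EFin \o f \+ (fun w => (D - 1)%:E * (EFin \o g) w))%E) => //.
  exact: integrableD.
- by move=> w _; rewrite lee_fin; exact: h_le.
Qed.

(** * Differential calculus on the circle *)

Lemma is_derive_S1 f w : S1_C1 f ->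
  is_derive (0 : R) 1 (fun t : R => f (S1_rotate t w)) (S1_derive f w).
Proof. by case=> _ df _; apply: DeriveDef. Qed.

Lemma is_derive_S1_mul_expR f g w : S1_C1 f -> S1_C1 g ->
  is_derive (0 : R) 1 (fun t : R => f (S1_rotate t w) * expR (g (S1_rotate t w)))
    (expR (g w) * (S1_derive f w + f w * S1_derive g w)).
Proof.
move=> /(is_derive_S1 w) df /(is_derive_S1 w) dg.
have de := is_derive1_comp (is_derive_expR (g (S1_rotate 0 w))) dg.
apply: is_derive_eq (is_deriveM df de) _.
by rewrite /GRing.scale /= S1_rotate0; ring.
Qed.

Lemma S1_C1_mul_expR f g : S1_C1 f -> S1_C1 g ->
  S1_C1 (fun w => f w * expR (g w)).
Proof.
move=> fC gC; have [cf _ cdf] := fC; have [cg _ cdg] := gC.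
have ce : continuous (fun w => expR (g w)).
  by move=> w; apply: continuous_comp; [exact: cg|exact: continuous_expR].
split.
- by move=> w; exact: (continuousM (cf w) (ce w)).
- by move=> w; have := is_derive_S1_mul_expR w fC gC => ?; exact: ex_derive.
have -> : S1_derive (fun w => f w * expR (g w)) =
    fun w => expR (g w) * (S1_derive f w + f w * S1_derive g w).
  apply/funext => w; have := is_derive_S1_mul_expR w fC gC => ?.
  exact: derive_val.
move=> w; apply: (continuousM (ce w)); apply: (continuousD (cdf w)).
exact: (continuousM (cf w) (cdg w)).
Qed.

Lemma S1_derive_ln f w : S1_C1 f -> 0 < f w ->
  S1_derive (fun v => ln (f v)) w = S1_derive f w / f w.
Proof.
move=> /(is_derive_S1 w) df fw0.
have dl : is_derive (f (S1_rotate 0 w)) 1 (@ln R) (f w)^-1.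
  by rewrite S1_rotate0; exact: is_derive1_ln.
by rewrite mulrC; case: (is_derive1_comp dl df).
Qed.

(** The tangent vector [(- y, x)] has Euclidean norm 1. *)
Lemma sqr_enorm_S1_grad f w : sqr_enorm (S1_grad f w) = S1_derive f w ^+ 2.
Proof.
rewrite /sqr_enorm /S1_grad /= -[RHS]mulr1 -(S1P w); ring.
Qed.

End S1_theory.

Theorem lemma2p1 (R : realType) (rho Psi : S1 R -> R) (lambda eps : R)
  (rho_pdf : S1_pdf rho)
  (Psi_pdf : S1_pdf (fun w => expR (- Psi w)))
  (rho_C1 : S1_C1 rho) (Psi_C1 : S1_C1 Psi)
  (Psi_le : forall w, `|Psi w| <= lambda)
  (eps_gt0 : 0 < eps) (eps_le : eps <= 1 / 10)
  (rho_near : ('N[arc_length]_+oo[(fun w => (rho w * expR (Psi w) - 1)%:E)]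
                 <= eps%:E)%E) :
  (rel_entropy rho (fun w => expR (- Psi w)) <=
     (2 * pi ^+ 2 * expR (2 * lambda) * (1 + 1 / 15 * eps)
        / (1 - 7 / 6 * eps))%:E
     * rel_Fisher rho (fun w => expR (- Psi w)))%E.
Proof.
set g := fun w => expR (- Psi w); pose u w := rho w * expR (Psi w).
have uE w : rho w / g w = u w by rewrite /g expRN invrK.
have uC1 : S1_C1 u by exact: S1_C1_mul_expR.
have [cu _ cdu] := uC1; have [crho _ _] := rho_C1; have [cPsi _ _] := Psi_C1.
have cu1 : continuous (fun w => u w - 1).
  move=> w; apply: (@continuousB _ R^o _ u (cst 1)); first exact: cu.
  exact: cst_continuous.
have u_near : forall w, `|u w - 1| <= eps := Lnormy_continuous_le cu1 rho_near.
have u0 w : 0 < u w.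
  by move: (u_near w); rewrite ler_norml => /andP[? _]; lra.
have u_le w : u w <= 1 + eps.
  by move: (u_near w); rewrite ler_norml => /andP[_ ?]; lra.
have [_ rho_ge0 _] := rho_pdf.
have rho0 w : 0 < rho w by have := u0 w; rewrite pmulr_lgt0 ?expR_gt0.
have [x [y uxy]] := S1_EVT cu.
(* Any point of the circle would do; [x] is at hand. *)
have lambda_ge0 : 0 <= lambda by exact: le_trans (Psi_le x).
have pi_ge1 : 1 <= pi :> R by have := pi_ge2 R; lra.
(* [K] bounds [expR (Psi w) * u w], the factor between the squared derivative of [u] and the Fisher
   integrand [q]. *)
pose K := expR lambda * (1 + eps).
have K0 : 0 < K by rewrite mulr_gt0 ?expR_gt0 //; lra.
pose q w := (S1_derive u w / u w) ^+ 2 * rho w.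
have q0 w : 0 <= q w by rewrite mulr_ge0 ?sqr_ge0.
have FisherE : rel_Fisher rho g = (\int[arc_length]_w (q w)%:E)%E.
  rewrite /rel_Fisher; apply: eq_integral => w _.
  rewrite sqr_enorm_S1_grad; under eq_fun do rewrite uE.
  by rewrite S1_derive_ln.
have cq : continuous q.
  move=> w; apply: (@continuousM _ _ (fun w => (S1_derive u w / u w) ^+ 2)).
    apply: (@continuous_comp _ _ _ (fun w => S1_derive u w / u w)
      (fun z => z ^+ 2)); last exact: exprn_continuous.
    apply: (continuousM (cdu w)); apply: continuousV (cu w).
    by rewrite gt_eqF.
  exact: crho.
have expPsi_le w : expR (Psi w) <= expR lambda.
  by rewrite ler_expR (le_trans (ler_norm _)).
have du_le w : S1_derive u w ^+ 2 <= K * q w.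
  (* Since [rho * expR Psi = u], the factor [expR Psi * u] turns the weight [rho] of [q] into
     [u ^+ 2], which cancels the denominator. *)
  have -> : S1_derive u w ^+ 2 = expR (Psi w) * u w * q w.
    rewrite /q; have : u w != 0 by rewrite gt_eqF.
    have -> : expR (Psi w) * u w * ((S1_derive u w / u w) ^+ 2 * rho w) =
      (S1_derive u w / u w) ^+ 2 * (rho w * expR (Psi w)) * u w by ring.
    by rewrite -/(u w) => ?; field.
  apply: ler_wpM2r => //.
  by apply: ler_pM => //; exact: ltW.
have int_q0 : (0 <= \int[arc_length]_w (q w)%:E)%E.
  by apply: integral_ge0 => w _; rewrite lee_fin.
have mq : measurable_fun [set: S1 R] (EFin \o q).
  by apply/measurable_EFinP; exact: continuous_measurable_fun_S1.
have int_du_le : (\int[arc_length]_w (S1_derive u w ^+ 2)%:E <=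
    K%:E * \int[arc_length]_w (q w)%:E)%E.
  rewrite -ge0_integralZl //; first last.
  - by rewrite lee_fin ltW.
  - by move=> w _; rewrite lee_fin.
  apply: ge0_le_integral => //.
  - by move=> w _; rewrite lee_fin sqr_ge0.
  - apply/measurable_EFinP; apply: measurable_funX.
    exact: continuous_measurable_fun_S1.
  - exact: measurable_funeM.
  - by move=> w _; rewrite -EFinM lee_fin.
have H_le : (rel_entropy rho g <= ((u y - u x) ^+ 2)%:E)%E.
  apply: rel_entropy_le => //.
  - move=> w; apply: continuous_comp; last exact: continuous_expR.
    exact: (continuousN (cPsi w)).
  - by move=> w; exact: expR_gt0.
  - by move=> w; rewrite uE.
apply: le_trans H_le _; apply: le_trans (S1_oscillation_le _ _ uC1) _.
have pi0 := pi_gt0 R.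
apply: (@le_trans _ _ ((2 * pi)%:E * (K%:E * \int[arc_length]_w (q w)%:E))%E).
  by apply: lee_wpmul2l => //; rewrite lee_fin; lra.
rewrite FisherE muleA -EFinM; apply: lee_wpmul2r => //; rewrite lee_fin.
have e1 : 1 <= expR lambda.
  by rewrite -[1]expR0 ler_expR.
have -> : expR (2 * lambda) = expR lambda * expR lambda.
  by rewrite -expRD; congr expR; ring.
(* The denominator is positive because [eps <= 1 / 10]. *)
rewrite ler_pdivlMr /K; last by lra.
have -> : 2 * pi * (expR lambda * (1 + eps)) * (1 - 7 / 6 * eps) =
  2 * pi * expR lambda * ((1 + eps) * (1 - 7 / 6 * eps)) by ring.
have -> : 2 * pi ^+ 2 * (expR lambda * expR lambda) * (1 + 1 / 15 * eps) =
  2 * pi * expR lambda * (pi * expR lambda * (1 + 1 / 15 * eps)) by ring.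
rewrite ler_pM2l; last by rewrite !mulr_gt0 // expR_gt0.
have pe : 1 <= pi * expR lambda by rewrite -[1]mulr1 ler_pM.
(* The left side is [1 - eps / 6 - 7 / 6 * eps ^+ 2], at most 1; each factor on the right is at
   least 1. *)
apply: (@le_trans _ _ 1); first by nra.
by rewrite -[1]mulr1 ler_pM //; lra.
Qed.
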